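(* Let $P$ be an arbitrary set, let $\mathcal{DS}$ be the category of the cocartesian monoidal monad freely generated by $P$ as set of generating objects, and let $\mathit{Fun}$ be the category of all functions between finite ordinals. Then the functor $G:\mathcal{DS}\to\mathit{Fun}$ defined in the context is faithful; i.e. for all objects $A,B$ and all arrows $f,g:A\to B$ of $\mathcal{DS}$, if $Gf=Gg$, then $f=g$.
   Context: A cocartesian category is a (symmetric) monoidal category whose monoidal structure is given by finite coproducts: $\otimes$ is binary coproduct, $I$ is the initial object, and $a_{A,B,C}:(A\otimes B)\otimes C\to A\otimes(B\otimes C)$, $l_A:I\otimes A\to A$, $r_A:A\otimes I\to A$, $c_{A,B}:A\otimes B\to B\otimes A$ are the canonical isomorphisms. $\nabla_A:A\otimes A\to A$ is the codiagonal, $!_A:I\to A$ is the unique arrow from the initial object, and the injections are $\iota^1_{A,B}=(\mathbf 1_A\otimes !_B)\circ r_A^{-1}:A\to A\otimes B$ and $\iota^2_{A,B}=(!_A\otimes\mathbf 1_B)\circ l_B^{-1}:B\to A\otimes B$. $\mathbf 1_A$ denotes the identity arrow of $A$. A cocartesian monoidal monad is a cocartesian category together with a monad $\langle T,\eta,\mu\rangle$ in it (with $\eta_A:A\to TA$, $\mu_A:TTA\to TA$). One then defines $\psi_{A,B}=\nabla_{T(A\otimes B)}\circ(T\iota^1_{A,B}\otimes T\iota^2_{A,B}):TA\otimes TB\to T(A\otimes B)$, $\psi^L_{A,B}=\psi_{A,B}\circ(\mathbf 1_{TA}\otimes\eta_B)$ and $\psi^R_{A,B}=\psi_{A,B}\circ(\eta_A\otimes\mathbf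 1_{TB})$. (Equivalently: a symmetric monoidal monad in a cocartesian category, i.e. a monad whose endofunctor is symmetric monoidal via $\psi$ and $\psi_0=\eta_I$ and whose $\eta,\mu$ are monoidal natural transformations, such that $\psi$ satisfies the displayed equation.) $\mathcal{DS}$ is the free such structure on $P$: its objects are the formal expressions built from elements of $P$ (propositional letters) and $I$ by $\otimes$ and $T$; its arrows are arrow terms built from identities, $a,a^{-1},l,l^{-1},r,r^{-1},c,\nabla,!,\eta,\mu$ (and $\psi^L,\psi^R$) by $\circ$, $\otimes$ and $T$, modulo the congruence generated by the equations of categories, functoriality, naturality, finite coproducts, monads, and the equations above. $\mathit{Fun}$ has as objects the finite ordinals $n=\{0,\dots,n-1\}$ and as arrows arbitrary functions between them. The functor $G$: $GA$ is the number of occurrences of propositional letters in $A$ plus the number of occurrences of $T$ in $A$ (occurrences of $I$ are not counted); the elements $0,\dots,GA-1$ of $GA$ correspond to these occurrences counted from right to left in $A$. On arrow terms: $G$ of an identity, of $a_{A,B,C}$, $l_A$, $r_A$ and their inverses, and of $\psi^L_{A,B}$ is the identity function; $G\psi^R_{A,B}$ is the bijection that sends the occurrence of $T$ immediately in front of $B$ in the source $A\otimes TB$ to the outermost (leftmost) occurrence of $T$ in the target $T(A\otimes B)$, and sends every counted occurrence inside $A$, respectively inside $B$, to the corresponding occurrence inside $A$, respectively $B$; $Gc_{A,B}$ is the bijection sending every occurrence in $A$, respectively $B$, in the source $A\otimes B$ to the corresponding occurrence in $A$, respectively $B$, in the target $B\otimes A$; $G\nabla_A$ sends every occurrence in either copy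 of $A$ in $A\otimes A$ to the corresponding occurrence in the target $A$; $G!_A$ is the empty function from $\emptyset$ to $GA$; $G\eta_A:GA\to GA+1$ is $i\mapsto i$; $G\mu_A:GA+2\to GA+1$ is $i\mapsto i$ for $i\le GA$ and $GA+1\mapsto GA$; $G(f\otimes g)$ is the juxtaposition of $Gf$ (on the left, i.e. on the larger elements) and $Gg$ (on the right, i.e. on the smaller elements); $GTf$ extends $Gf$ by sending the new leftmost (greatest) element of the source to the new leftmost (greatest) element of the target; $G(g\circ f)=Gg\circ Gf$. *)

(* Defs.v *)
From mathcomp Require Import all_boot.

Set Implicit Arguments.
Unset Strict Implicit.
Unset Printing Implicit Defensive.

Declare Scope obj_scope.
Declare Scope hom_scope.
Delimit Scope obj_scope with obj.
Delimit Scope hom_scope with hom.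

(* The category DS is presented syntactically: its objects are the formal
   expressions [obj P]; its arrows A -> B are the arrow terms [hom A B] modulo
   the congruence [eqv] (written f ≡ g), so that equality of arrows of DS is
   ≡ between terms. *)

Inductive obj (P : Type) : Type :=
| Letter of P
| Unit
| Tensor of obj P & obj P
| T of obj P.

Arguments Unit {P}.
Bind Scope obj_scope with obj.
Notation "A ⊗ B" := (Tensor A B) (at level 35, right associativity) : obj_scope.

Inductive hom (P : Type) : obj P -> obj P -> Type :=
| Id A : hom A A
| Comp A B C : hom B C -> hom A B -> hom A C
| TensorM A B A' B' : hom A A' -> hom B B' -> hom (A ⊗ B) (A' ⊗ B')
| TM A B : hom A B -> hom (T A) (T B)
| Assoc A B C : hom ((A ⊗ B) ⊗ C) (A ⊗ (B ⊗ C))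
| AssocV A B C : hom (A ⊗ (B ⊗ C)) ((A ⊗ B) ⊗ C)
| LUnit A : hom (Unit ⊗ A) A
| LUnitV A : hom A (Unit ⊗ A)
| RUnit A : hom (A ⊗ Unit) A
| RUnitV A : hom A (A ⊗ Unit)
| Sym A B : hom (A ⊗ B) (B ⊗ A)
| Nabla A : hom (A ⊗ A) A
| Bang A : hom Unit A
| Eta A : hom A (T A)
| Mu A : hom (T (T A)) (T A)
| PsiL A B : hom (T A ⊗ B) (T (A ⊗ B))
| PsiR A B : hom (A ⊗ T B) (T (A ⊗ B)).

Arguments Id {P} A.
Arguments Assoc {P} A B C.
Arguments AssocV {P} A B C.
Arguments LUnit {P} A.
Arguments LUnitV {P} A.
Arguments RUnit {P} A.
Arguments RUnitV {P} A.
Arguments Sym {P} A B.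
Arguments Nabla {P} A.
Arguments Bang {P} A.
Arguments Eta {P} A.
Arguments Mu {P} A.
Arguments PsiL {P} A B.
Arguments PsiR {P} A B.

Bind Scope hom_scope with hom.
Notation "g ∘ f" := (Comp g f) (at level 40, left associativity) : hom_scope.
Notation "f ⊗ g" := (TensorM f g) (at level 35, right associativity) : hom_scope.

Local Open Scope hom_scope.

Definition inj1 P (A B : obj P) : hom A (A ⊗ B) := (Id A ⊗ Bang B) ∘ RUnitV A.
Definition inj2 P (A B : obj P) : hom B (A ⊗ B) := (Bang A ⊗ Id B) ∘ LUnitV B.

Definition psi P (A B : obj P) : hom (T A ⊗ T B) (T (A ⊗ B)) :=
  Nabla (T (A ⊗ B)) ∘ (TM (inj1 A B) ⊗ TM (inj2 A B)).

Reserved Notation "f ≡ g" (at level 70, no associativity).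

Inductive eqv (P : Type) : forall A B : obj P, hom A B -> hom A B -> Prop :=
| eqv_refl A B (f : hom A B) : f ≡ f
| eqv_sym A B (f g : hom A B) : f ≡ g -> g ≡ f
| eqv_trans A B (f g h : hom A B) : f ≡ g -> g ≡ h -> f ≡ h
| eqv_comp A B C (g g' : hom B C) (f f' : hom A B) :
    g ≡ g' -> f ≡ f' -> g ∘ f ≡ g' ∘ f'
| eqv_tensorm A B A' B' (f f' : hom A A') (g g' : hom B B') :
    f ≡ f' -> g ≡ g' -> f ⊗ g ≡ f' ⊗ g'
| eqv_Tm A B (f f' : hom A B) : f ≡ f' -> TM f ≡ TM f'
| eqv_idl A B (f : hom A B) : Id B ∘ f ≡ f
| eqv_idr A B (f : hom A B) : f ∘ Id A ≡ f
| eqv_compA A B C D (h : hom C D) (g : hom B C) (f : hom A B) :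
    h ∘ (g ∘ f) ≡ (h ∘ g) ∘ f
| eqv_tensorm_id A B : Id A ⊗ Id B ≡ Id (A ⊗ B)
| eqv_tensorm_comp A1 A2 A3 B1 B2 B3 (g1 : hom A2 A3) (f1 : hom A1 A2)
      (g2 : hom B2 B3) (f2 : hom B1 B2) :
    (g1 ∘ f1) ⊗ (g2 ∘ f2) ≡ (g1 ⊗ g2) ∘ (f1 ⊗ f2)
| eqv_Tm_id A : TM (Id A) ≡ Id (T A)
| eqv_Tm_comp A B C (g : hom B C) (f : hom A B) : TM (g ∘ f) ≡ TM g ∘ TM f
| eqv_assoc_nat A B C A' B' C' (f : hom A A') (g : hom B B') (h : hom C C') :
    Assoc A' B' C' ∘ ((f ⊗ g) ⊗ h) ≡ (f ⊗ (g ⊗ h)) ∘ Assoc A B C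
| eqv_assocK A B C : AssocV A B C ∘ Assoc A B C ≡ Id ((A ⊗ B) ⊗ C)
| eqv_assocVK A B C : Assoc A B C ∘ AssocV A B C ≡ Id (A ⊗ (B ⊗ C))
| eqv_lunit_nat A B (f : hom A B) : LUnit B ∘ (Id Unit ⊗ f) ≡ f ∘ LUnit A
| eqv_lunitK A : LUnitV A ∘ LUnit A ≡ Id (Unit ⊗ A)
| eqv_lunitVK A : LUnit A ∘ LUnitV A ≡ Id A
| eqv_runit_nat A B (f : hom A B) : RUnit B ∘ (f ⊗ Id Unit) ≡ f ∘ RUnit A
| eqv_runitK A : RUnitV A ∘ RUnit A ≡ Id (A ⊗ Unit)
| eqv_runitVK A : RUnit A ∘ RUnitV A ≡ Id A
| eqv_sym_nat A B A' B' (f : hom A A') (g : hom B B') :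
    Sym A' B' ∘ (f ⊗ g) ≡ (g ⊗ f) ∘ Sym A B
| eqv_symK A B : Sym B A ∘ Sym A B ≡ Id (A ⊗ B)
| eqv_pentagon A B C D :
    Assoc A B (C ⊗ D) ∘ Assoc (A ⊗ B) C D ≡
    (Id A ⊗ Assoc B C D) ∘ Assoc A (B ⊗ C) D ∘ (Assoc A B C ⊗ Id D)
| eqv_triangle A B : (Id A ⊗ LUnit B) ∘ Assoc A Unit B ≡ RUnit A ⊗ Id B
| eqv_hexagon A B C :
    Assoc B C A ∘ Sym A (B ⊗ C) ∘ Assoc A B C ≡
    (Id B ⊗ Sym A C) ∘ Assoc B A C ∘ (Sym A B ⊗ Id C)
| eqv_lunit_sym A : LUnit A ∘ Sym A Unit ≡ RUnit A
(* Unit is initial, and ⊗ is binary coproduct: the copairing of f and g is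
   Nabla ∘ (f ⊗ g), and [eqv_nabla_inj] gives its uniqueness *)
| eqv_bang A (f : hom Unit A) : f ≡ Bang A
| eqv_nabla_nat A B (f : hom A B) : Nabla B ∘ (f ⊗ f) ≡ f ∘ Nabla A
| eqv_nabla_inj1 A : Nabla A ∘ inj1 A A ≡ Id A
| eqv_nabla_inj2 A : Nabla A ∘ inj2 A A ≡ Id A
| eqv_nabla_inj A B : Nabla (A ⊗ B) ∘ (inj1 A B ⊗ inj2 A B) ≡ Id (A ⊗ B)
| eqv_eta_nat A B (f : hom A B) : Eta B ∘ f ≡ TM f ∘ Eta A
| eqv_mu_nat A B (f : hom A B) : Mu B ∘ TM (TM f) ≡ TM f ∘ Mu A
| eqv_mu_etaT A : Mu A ∘ Eta (T A) ≡ Id (T A)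
| eqv_mu_Teta A : Mu A ∘ TM (Eta A) ≡ Id (T A)
| eqv_mu_mu A : Mu A ∘ TM (Mu A) ≡ Mu A ∘ Mu (T A)
| eqv_psiL A B : PsiL A B ≡ psi A B ∘ (Id (T A) ⊗ Eta B)
| eqv_psiR A B : PsiR A B ≡ psi A B ∘ (Eta A ⊗ Id (T B))
where "f ≡ g" := (@eqv _ _ _ f g).

Notation "f ≡ g" := (@eqv _ _ _ f g) : type_scope.

(* Number of occurrences of letters and of T. Occurrences are numbered from
   right to left, whence the order of the summands: in A ⊗ B the occurrences
   of B are 0, ..., cnt B - 1 (the image of [lshift]) and those of A come next
   (the image of [rshift]). *)
Fixpoint cnt P (A : obj P) : nat :=
  match A with
  | Letter _ => 1
  | Unit => 0
  | Tensor A B => cnt B + cnt A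
  | T A => (cnt A).+1
  end.

(* An arrow m -> n of Fun is a {ffun 'I_m -> 'I_n}. In 'I_n.+1, [ord_max] is the
   greatest element n, and [lift ord_max i] is the element with the same value
   as i : 'I_n ([lift_max]); [unlift ord_max] discriminates between the two. *)

Definition fun_tensor m n m' n' (f : {ffun 'I_m -> 'I_m'})
    (g : {ffun 'I_n -> 'I_n'}) : {ffun 'I_(n + m) -> 'I_(n' + m')} :=
  [ffun i => match split i with
             | inl j => lshift m' (g j)
             | inr j => rshift n' (f j)
             end].

Definition fun_T m n (f : {ffun 'I_m -> 'I_n}) : {ffun 'I_m.+1 -> 'I_n.+1} :=
  [ffun i => if unlift ord_max i is Some j then lift ord_max (f j) else ord_max].

Definition fun_sym m n : {ffun 'I_(n + m) -> 'I_(m + n)} :=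
  [ffun i => match split i with
             | inl j => rshift m j
             | inr j => lshift n j
             end].

Definition fun_nabla n : {ffun 'I_(n + n) -> 'I_n} :=
  [ffun i => match split i with inl j => j | inr j => j end].

Definition fun_bang n : {ffun 'I_0 -> 'I_n} :=
  [ffun i : 'I_0 => match notF (ltn_ord i) with end].

Definition fun_eta n : {ffun 'I_n -> 'I_n.+1} := [ffun i => lift ord_max i].

Definition fun_mu n : {ffun 'I_n.+2 -> 'I_n.+1} :=
  [ffun i => if unlift ord_max i is Some j then j else ord_max].

(* In the source A ⊗ T B, the elements of B come first, then the T, then the
   elements of A. *)
Definition fun_psiR m n : {ffun 'I_(n.+1 + m) -> 'I_(n + m).+1} :=
  [ffun i => match split i with
             | inl j => if unlift ord_max j is Some k
                        then lift ord_max (lshift m k) else ord_max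
             | inr j => lift ord_max (rshift n j)
             end].

(* The identity function, between ordinals that are equal but not convertible *)
Definition fun_cast m n (e : m = n) : {ffun 'I_m -> 'I_n} :=
  [ffun i => cast_ord e i].

Fixpoint G P (A B : obj P) (f : hom A B) : {ffun 'I_(cnt A) -> 'I_(cnt B)} :=
  match f in hom A B return {ffun 'I_(cnt A) -> 'I_(cnt B)} with
  | Id A => [ffun i => i]
  | Comp _ _ _ g f => [ffun i => G g (G f i)]
  | TensorM _ _ _ _ f g => fun_tensor (G f) (G g)
  | TM _ _ f => fun_T (G f)
  | Assoc A B C => fun_cast (addnA (cnt C) (cnt B) (cnt A))
  | AssocV A B C => fun_cast (esym (addnA (cnt C) (cnt B) (cnt A)))
  | LUnit A => fun_cast (addn0 (cnt A))
  | LUnitV A => fun_cast (esym (addn0 (cnt A)))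
  | RUnit A => fun_cast (add0n (cnt A))
  | RUnitV A => fun_cast (esym (add0n (cnt A)))
  | Sym A B => fun_sym (cnt A) (cnt B)
  | Nabla A => fun_nabla (cnt A)
  | Bang A => fun_bang (cnt A)
  | Eta A => fun_eta (cnt A)
  | Mu A => fun_mu (cnt A)
  | PsiL A B => fun_cast (addnS (cnt B) (cnt A))
  | PsiR A B => fun_psiR (cnt A) (cnt B)
  end.

Lemma fun_tensorl m n m' n' (f : {ffun 'I_m -> 'I_m'})
    (g : {ffun 'I_n -> 'I_n'}) j :
  fun_tensor f g (lshift m j) = lshift m' (g j).
Proof. by rewrite ffunE (unsplitK (inl j)). Qed.

Lemma fun_tensorr m n m' n' (f : {ffun 'I_m -> 'I_m'})
    (g : {ffun 'I_n -> 'I_n'}) j :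
  fun_tensor f g (rshift n j) = rshift n' (f j).
Proof. by rewrite ffunE (unsplitK (inr j)). Qed.

Lemma fun_Tlift m n (f : {ffun 'I_m -> 'I_n}) j :
  fun_T f (lift ord_max j) = lift ord_max (f j).
Proof. by rewrite ffunE liftK. Qed.

Lemma fun_Tmax m n (f : {ffun 'I_m -> 'I_n}) : fun_T f ord_max = ord_max.
Proof. by rewrite ffunE unlift_none. Qed.

Lemma fun_syml m n j : fun_sym m n (lshift m j) = rshift m j.
Proof. by rewrite ffunE (unsplitK (inl j)). Qed.

Lemma fun_symr m n j : fun_sym m n (rshift n j) = lshift n j.
Proof. by rewrite ffunE (unsplitK (inr j)). Qed.

Lemma fun_nablal n j : fun_nabla n (lshift n j) = j.
Proof. by rewrite ffunE (unsplitK (inl j)). Qed.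

Lemma fun_nablar n j : fun_nabla n (rshift n j) = j.
Proof. by rewrite ffunE (unsplitK (inr j)). Qed.

Lemma fun_etaE n j : fun_eta n j = lift ord_max j.
Proof. by rewrite ffunE. Qed.

Lemma fun_mulift n j : fun_mu n (lift ord_max j) = j.
Proof. by rewrite ffunE liftK. Qed.

Lemma fun_mumax n : fun_mu n ord_max = ord_max.
Proof. by rewrite ffunE unlift_none. Qed.

Lemma fun_psiRlift m n j :
  fun_psiR m n (lshift m (lift ord_max j)) = lift ord_max (lshift m j).
Proof. by rewrite ffunE (unsplitK (inl _)) liftK. Qed.

Lemma fun_psiRmax m n : fun_psiR m n (lshift m ord_max) = ord_max.
Proof. by rewrite ffunE (unsplitK (inl _)) unlift_none. Qed.

Lemma fun_psiRr m n j : fun_psiR m n (rshift n.+1 j) = lift ord_max (rshift n j).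
Proof. by rewrite ffunE (unsplitK (inr j)). Qed.

Definition funE := (fun_tensorl, fun_tensorr, fun_Tlift, fun_Tmax, fun_syml,
  fun_symr, fun_nablal, fun_nablar, fun_etaE, fun_mulift, fun_mumax,
  fun_psiRlift, fun_psiRmax, fun_psiRr).

Lemma fun_cast_assocl m n p (i : 'I_m) : fun_cast (addnA m n p) (lshift (n + p) i) =
  lshift p (lshift n i).
Proof. by apply/val_inj; rewrite ffunE. Qed.

Lemma fun_cast_assocm m n p (j : 'I_n) : fun_cast (addnA m n p) (rshift m (lshift p j)) =
  lshift p (rshift m j).
Proof. by apply/val_inj; rewrite ffunE. Qed.

Lemma fun_cast_assocr m n p (k : 'I_p) : fun_cast (addnA m n p) (rshift m (rshift n k)) =
  rshift (m + n) k.
Proof. by apply/val_inj; rewrite ffunE /= addnA. Qed.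

Lemma fun_cast_lunit m (i : 'I_m) : fun_cast (addn0 m) (lshift 0 i) = i.
Proof. by apply/val_inj; rewrite ffunE. Qed.

Lemma fun_cast_lunitV m (i : 'I_m) : fun_cast (esym (addn0 m)) i = lshift 0 i.
Proof. by apply/val_inj; rewrite ffunE. Qed.

Lemma fun_cast_runit m (i : 'I_m) : fun_cast (add0n m) (rshift 0 i) = i.
Proof. by apply/val_inj; rewrite ffunE. Qed.

Lemma fun_cast_runitV m (i : 'I_m) : fun_cast (esym (add0n m)) i = rshift 0 i.
Proof. by apply/val_inj; rewrite ffunE. Qed.

Lemma fun_cast_psiLl m n (i : 'I_m) :
  fun_cast (addnS m n) (lshift n.+1 i) = lift ord_max (lshift n i).
Proof. by apply/ord_inj; rewrite ffunE lift_max. Qed.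

Lemma fun_cast_psiLr m n (j : 'I_n) :
  fun_cast (addnS m n) (rshift m (lift ord_max j)) = lift ord_max (rshift m j).
Proof. by apply/ord_inj; rewrite ffunE lift_max /= /bump leqNgt ltn_ord. Qed.

Lemma fun_cast_psiLmax m n : fun_cast (addnS m n) (rshift m ord_max) = ord_max.
Proof. by apply/val_inj; rewrite ffunE. Qed.

Lemma fun_castK m n (e : m = n) i : fun_cast (esym e) (fun_cast e i) = i.
Proof. by rewrite !ffunE cast_ordK. Qed.
Lemma fun_castKV m n (e : m = n) i : fun_cast e (fun_cast (esym e) i) = i.
Proof. by rewrite !ffunE cast_ordKV. Qed.

Definition castE := (fun_castK, fun_castKV, fun_cast_assocl, fun_cast_assocm,
  fun_cast_assocr, fun_cast_lunit, fun_cast_lunitV, fun_cast_runit,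
  fun_cast_runitV, fun_cast_psiLl, fun_cast_psiLr, fun_cast_psiLmax).

Lemma G_Comp P (A B C : obj P) (g : hom B C) (f : hom A B) i :
  G (g ∘ f) i = G g (G f i).
Proof. by rewrite /= ffunE. Qed.

Lemma G_Id P (A : obj P) i : G (Id A) i = i.
Proof. by rewrite /= ffunE. Qed.

Lemma G_inj1 P (A B : obj P) i : G (inj1 A B) i = rshift (cnt B) i.
Proof. by rewrite G_Comp [G (RUnitV A)]/= fun_cast_runitV fun_tensorr G_Id. Qed.

Lemma G_inj2 P (A B : obj P) i : G (inj2 A B) i = lshift (cnt A) i.
Proof. by rewrite G_Comp [G (LUnitV B)]/= fun_cast_lunitV fun_tensorl G_Id. Qed.

Ltac ord_cases := repeat match goal with
  | i : 'I_0 |- _ => by case: i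
  | i : 'I_(_ + _) |- _ => case: (split_ordP i) => ? {i}->
  | i : 'I_(_.+1) |- _ => case: (unliftP ord_max i) => [?|] {i}->
  end.

(* Hence G is well defined on arrows of DS. *)
Lemma G_eqv P (A B : obj P) (f g : hom A B) : f ≡ g -> G f = G g.
Proof.
elim=> {A B f g} //.
- by move=> A B f g h _ -> _ ->.
- by move=> A B C g g' f f' _ /= -> _ ->.
- by move=> A B A' B' f f' g g' _ /= -> _ ->.
- by move=> A B f f' _ /= ->.
all: intros; apply/ffunP; cbn -[inj1 inj2 G]; intro; cbn [cnt] in *; ord_cases.
all: rewrite ?/psi; do ?[rewrite !G_Comp | rewrite !G_inj1 | rewrite !G_inj2
  | rewrite !G_Id | progress cbn [G] | rewrite !funE | rewrite !castE
  | rewrite ffunE] => //.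
all: by rewrite ?liftK ?unlift_none ?G_inj1 ?G_inj2.
Qed.

(* Main.v *)
Require Import Defs.
From mathcomp Require Import all_boot.
From Stdlib Require Import Setoid Morphisms Eqdep Program.Equality.

Set Implicit Arguments.
Unset Strict Implicit.
Unset Printing Implicit Defensive.

(** The proof brings every arrow term to a normal form that can be read off
    from its image under [G].

    An arrow out of a coproduct is determined by its components, so one has to
    understand the arrows X -> B where X is a letter or X = T A. Such an arrow
    goes to one place in B: a [route] is a composite of injections and units
    that follows a path down the expression B to one of its subexpressions. An
    arrow from a letter is a route starting at an occurrence of that letter. An
    arrow from T A is a route starting at some T C, preceded by the Kleisli
    extension [bind h] of an arrow h : A -> T C, and h is smaller in that its
    source is A. The predicate [normal] says that a term is equal to one
    decomposed in this way, recursively in its source. All generators are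
    normal, and normality is stable under composition ([normal_comp]): a route
    into the source of a normal arrow selects one of the data from which the
    latter is built, and two Kleisli extensions compose to a Kleisli extension.
    Hence all terms are normal ([normal_hom]).

    The function [G f] determines the normal form. The image of the source letter,
    or of the outermost T of the source, is the occurrence in B at which the route
    starts, and this fixes the route ([route_unique]). [G] of a route is
    injective and [G (bind h)] restricts to [G h], so that [G f] determines [G h],
    and h is determined by induction on the source ([normal_faithful]). *)

Local Open Scope hom_scope.

(** * Coproduct calculus *)

#[local] Instance eqv_equivalence P (A B : obj P) : Equivalence (@eqv P A B).
Proof.
by split; [exact: eqv_refl | exact: eqv_sym | exact: eqv_trans].
Qed.

#[local] Hint Resolve eqv_refl : core.

#[local] Instance Comp_proper P (A B C : obj P) :
  Proper (@eqv P B C ==> @eqv P A B ==> @eqv P A C) (@Comp P A B C).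
Proof. by move=> g g' eg f f' ef; apply: eqv_comp. Qed.

#[local] Instance TensorM_proper P (A B A' B' : obj P) :
  Proper (@eqv P A A' ==> @eqv P B B' ==> @eqv P (Tensor A B) (Tensor A' B'))
    (@TensorM P A B A' B').
Proof. by move=> f f' ef g g' eg; apply: eqv_tensorm. Qed.

#[local] Instance TM_proper P (A B : obj P) :
  Proper (@eqv P A B ==> @eqv P (T A) (T B)) (@TM P A B).
Proof. by move=> f f' ef; apply: eqv_Tm. Qed.

Lemma cancel_mono P (A B C : obj P) (m : hom B C) (s : hom C B)
    (f g : hom A B) :
  s ∘ m ≡ Id B -> m ∘ f ≡ m ∘ g -> f ≡ g.
Proof.
by move=> sm fg; rewrite -(eqv_idl f) -(eqv_idl g) -sm -!eqv_compA fg.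
Qed.

Lemma runitV_nat P (A B : obj P) (f : hom A B) :
  RUnitV B ∘ f ≡ (f ⊗ Id Unit) ∘ RUnitV A.
Proof.
apply: (cancel_mono (eqv_runitK B)).
by rewrite !eqv_compA eqv_runit_nat eqv_runitVK eqv_idl -eqv_compA eqv_runitVK
  eqv_idr.
Qed.

Lemma lunitV_nat P (A B : obj P) (f : hom A B) :
  LUnitV B ∘ f ≡ (Id Unit ⊗ f) ∘ LUnitV A.
Proof.
apply: (cancel_mono (eqv_lunitK B)).
by rewrite !eqv_compA eqv_lunit_nat eqv_lunitVK eqv_idl -eqv_compA eqv_lunitVK
  eqv_idr.
Qed.

Lemma from_unit P (A : obj P) (f g : hom Unit A) : f ≡ g.
Proof. by rewrite (eqv_bang f) (eqv_bang g). Qed.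

Lemma tensor_inj1 P (A B A' B' : obj P) (f : hom A A') (g : hom B B') :
  (f ⊗ g) ∘ inj1 A B ≡ inj1 A' B' ∘ f.
Proof.
rewrite /inj1 -eqv_compA runitV_nat !eqv_compA -!eqv_tensorm_comp.
by rewrite eqv_idl !eqv_idr (eqv_bang (g ∘ _)).
Qed.

Lemma tensor_inj2 P (A B A' B' : obj P) (f : hom A A') (g : hom B B') :
  (f ⊗ g) ∘ inj2 A B ≡ inj2 A' B' ∘ g.
Proof.
rewrite /inj2 -eqv_compA lunitV_nat !eqv_compA -!eqv_tensorm_comp.
by rewrite eqv_idl !eqv_idr (eqv_bang (f ∘ _)).
Qed.

Lemma copair_eta P (A B C : obj P) (f : hom (Tensor A B) C) :
  f ≡ Nabla C ∘ ((f ∘ inj1 A B) ⊗ (f ∘ inj2 A B)).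
Proof.
by rewrite eqv_tensorm_comp eqv_compA eqv_nabla_nat -eqv_compA eqv_nabla_inj
  eqv_idr.
Qed.

Lemma copair_ext P (A B C : obj P) (f g : hom (Tensor A B) C) :
  f ∘ inj1 A B ≡ g ∘ inj1 A B -> f ∘ inj2 A B ≡ g ∘ inj2 A B -> f ≡ g.
Proof. by move=> e1 e2; rewrite (copair_eta f) e1 e2 -copair_eta. Qed.

Lemma lunitV_inj2 P (A : obj P) : LUnitV A ≡ inj2 Unit A.
Proof.
by rewrite /inj2 (from_unit (Bang Unit) (Id Unit)) eqv_tensorm_id eqv_idl.
Qed.

Lemma runitV_inj1 P (A : obj P) : RUnitV A ≡ inj1 A Unit.
Proof.
by rewrite /inj1 (from_unit (Bang Unit) (Id Unit)) eqv_tensorm_id eqv_idl.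
Qed.

Lemma sym_inj1 P (A B : obj P) : Sym A B ∘ inj1 A B ≡ inj2 B A.
Proof.
rewrite /inj1 /inj2 eqv_compA eqv_sym_nat -eqv_compA.
suff -> : Sym A Unit ∘ RUnitV A ≡ LUnitV A by [].
rewrite -[Sym _ _]eqv_idl -eqv_lunitK -(eqv_compA (LUnitV A)) eqv_lunit_sym.
by rewrite -eqv_compA eqv_runitVK eqv_idr.
Qed.

Lemma lunit_inj2 P (A : obj P) : LUnit A ∘ inj2 Unit A ≡ Id A.
Proof. by rewrite -lunitV_inj2 eqv_lunitVK. Qed.

Lemma runit_inj1 P (A : obj P) : RUnit A ∘ inj1 A Unit ≡ Id A.
Proof. by rewrite -runitV_inj1 eqv_runitVK. Qed.

Lemma sym_inj2 P (A B : obj P) : Sym A B ∘ inj2 A B ≡ inj1 B A.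
Proof. by rewrite -sym_inj1 eqv_compA eqv_symK eqv_idl. Qed.

(** By naturality the two outer components of the associator can be computed
    with the two other objects equal to the unit, where the triangle equation
    determines the associator. *)
Lemma assoc_inj11 P (A B C : obj P) :
  Assoc A B C ∘ inj1 (Tensor A B) C ∘ inj1 A B ≡ inj1 A (Tensor B C).
Proof.
have e : Assoc A Unit Unit ∘ inj1 (Tensor A Unit) Unit
    ≡ inj1 A (Tensor Unit Unit) ∘ RUnit A.
  apply: (@cancel_mono _ _ _ _ (Id A ⊗ LUnit Unit) (Id A ⊗ LUnitV Unit)).
    by rewrite -eqv_tensorm_comp eqv_lunitK eqv_idl eqv_tensorm_id.
  rewrite 2!(eqv_compA (Id A ⊗ _)) eqv_triangle !tensor_inj1.
  by rewrite eqv_idr.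
have -> : Assoc A B C ∘ inj1 (Tensor A B) C ∘ inj1 A B
    ≡ Assoc A B C ∘ ((Id A ⊗ Bang B) ⊗ Bang C) ∘ inj1 _ Unit ∘ inj1 A Unit.
  by rewrite -!(eqv_compA (Assoc A B C)) tensor_inj1 -eqv_compA tensor_inj1
    eqv_idr.
rewrite eqv_assoc_nat -(eqv_compA _ (Assoc _ _ _)) e -2!eqv_compA.
by rewrite runit_inj1 eqv_idr tensor_inj1 eqv_idr.
Qed.

Lemma assoc_inj2 P (A B C : obj P) :
  Assoc A B C ∘ inj2 (Tensor A B) C ≡ inj2 A (Tensor B C) ∘ inj2 B C.
Proof.
have e : Assoc Unit Unit C ∘ inj2 (Tensor Unit Unit) C
    ≡ inj2 Unit (Tensor Unit C) ∘ inj2 Unit C.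
  apply: (@cancel_mono _ _ _ _ (Id Unit ⊗ LUnit C) (Id Unit ⊗ LUnitV C)).
    by rewrite -eqv_tensorm_comp eqv_lunitK eqv_idl eqv_tensorm_id.
  rewrite 2!(eqv_compA (Id Unit ⊗ _)) eqv_triangle !tensor_inj2.
  by rewrite -eqv_compA lunit_inj2.
have -> : inj2 (Tensor A B) C ≡ ((Bang A ⊗ Bang B) ⊗ Id C) ∘ inj2 _ _.
  by rewrite tensor_inj2 eqv_idr.
rewrite (eqv_compA (Assoc A B C)) eqv_assoc_nat -eqv_compA e.
rewrite (eqv_compA (Bang A ⊗ _)) tensor_inj2.
by rewrite -eqv_compA tensor_inj2 eqv_idr.
Qed.

(** The triangle equation says nothing about the middle component; the hexagon
    reduces it to the first component of another associator. *)
Lemma assoc_inj12 P (A B C : obj P) :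
  Assoc A B C ∘ inj1 (Tensor A B) C ∘ inj2 A B
    ≡ inj2 A (Tensor B C) ∘ inj1 B C.
Proof.
(* Both sides are followed by Sym, then by Assoc, to meet the hexagon. *)
apply: (cancel_mono (eqv_symK A (Tensor B C))).
rewrite (eqv_compA (Sym _ _) (inj2 _ _)) sym_inj2.
apply: (cancel_mono (eqv_assocK B C A)).
rewrite (eqv_compA (Assoc B C A) (inj1 _ _)) assoc_inj11.
rewrite !(eqv_compA _ _ (inj2 A B)) !(eqv_compA _ _ (inj1 (Tensor A B) C)).
rewrite (eqv_compA (Assoc B C A)) eqv_hexagon.
rewrite -(eqv_compA _ _ (inj1 _ C)) tensor_inj1.
rewrite -(eqv_compA _ _ (inj2 A B)) -(eqv_compA (inj1 _ C)) sym_inj2.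
by rewrite -(eqv_compA (Id B ⊗ _)) (eqv_compA (Assoc _ _ _)) assoc_inj11
  tensor_inj1 eqv_idr.
Qed.

(** * Kleisli calculus *)

Definition bind P (A B : obj P) (h : hom A (T B)) : hom (T A) (T B) :=
  Mu B ∘ TM h.

#[local] Instance bind_proper P (A B : obj P) :
  Proper (@eqv P A (T B) ==> @eqv P (T A) (T B)) (@bind P A B).
Proof. by move=> h h' eh; rewrite /bind eh. Qed.

Lemma bind_comp_Eta P (A B : obj P) (h : hom A (T B)) : bind h ∘ Eta A ≡ h.
Proof.
by rewrite /bind -eqv_compA -eqv_eta_nat eqv_compA eqv_mu_etaT eqv_idl.
Qed.

Lemma bind_Eta P (A : obj P) : bind (Eta A) ≡ Id (T A).
Proof. exact: eqv_mu_Teta. Qed.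

Lemma bind_bind P (A B C : obj P) (k : hom B (T C)) (h : hom A (T B)) :
  bind k ∘ bind h ≡ bind (bind k ∘ h).
Proof.
rewrite /bind !eqv_Tm_comp !eqv_compA eqv_mu_mu.
by rewrite -(eqv_compA (Mu C) (TM k)) -eqv_mu_nat eqv_compA.
Qed.

Lemma bind_Id P (A : obj P) : bind (Id (T A)) ≡ Mu A.
Proof. by rewrite /bind eqv_Tm_id eqv_idr. Qed.

Lemma bind_Eta_comp P (A B : obj P) (f : hom A B) : bind (Eta B ∘ f) ≡ TM f.
Proof. by rewrite /bind eqv_Tm_comp eqv_compA eqv_mu_Teta eqv_idl. Qed.

(** * Routes *)

(** Routes are specific terms, not classes of terms modulo [eqv]: this
    makes the route that starts at a given place unique up to Leibniz equality,
    so that source and route can be identified together. Each constructor adds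
    the last step, so that induction on a route follows the expression B from
    its root. *)
Inductive route P (C : obj P) : forall B, hom C B -> Prop :=
| route_id : route (Id C)
| route_inj1 B B' (r : hom C B) : route r -> route (inj1 B B' ∘ r)
| route_inj2 B B' (r : hom C B') : route r -> route (inj2 B B' ∘ r)
| route_eta B (r : hom C B) : route r -> route (Eta B ∘ r).

Lemma route_comp P (A B C : obj P) (s : hom B C) (r : hom A B) :
  route s -> route r -> exists2 q, route q & s ∘ r ≡ q.
Proof.
move=> rs rr.
elim: rs => {C s}
  [|C C' s _ [q rq e]|C C' s _ [q rq e]|C s _ [q rq e]].
- by exists r => //; apply: eqv_idl.
- by exists (inj1 C C' ∘ q); [apply: route_inj1 | rewrite -eqv_compA e].
- by exists (inj2 C C' ∘ q); [apply: route_inj2 | rewrite -eqv_compA e].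
- by exists (Eta C ∘ q); [apply: route_eta | rewrite -eqv_compA e].
Qed.

Lemma G_route_inj P (A B : obj P) (r : hom A B) : route r -> injective (G r).
Proof.
elim=> {B r} [|B B' r _ IH|B B' r _ IH|B r _ IH] i j.
- by rewrite !G_Id.
- by rewrite !(G_Comp (inj1 _ _)) !G_inj1 => /rshift_inj/IH.
- by rewrite !(G_Comp (inj2 _ _)) !G_inj2 => /lshift_inj/IH.
- by rewrite !(G_Comp (Eta _)) !fun_etaE => /lift_inj/IH.
Qed.

(** Every object is a finite coproduct of atoms, and atoms are connected: an
    arrow from an atom into a coproduct factors through an injection. *)
Definition atom P (A : obj P) :=
  match A with Letter _ | T _ => true | _ => false end.

(** For an atom C the number [(cnt C).-1] is that of its leftmost occurrence, the
    letter or the outermost T, which [G r] sends to the occurrence in B where the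
    route starts. The two routes are compared step by step from the root of B: at
    a coproduct the images lie in different summands unless the injections agree,
    and at T B the image is the outermost T exactly for the identity route. The
    sources are only found to be equal along the way, whence the equality of
    dependent pairs. *)
Lemma route_unique P (B C C' : obj P) (r : hom C B) (r' : hom C' B)
    (i : 'I_(cnt C)) (i' : 'I_(cnt C')) :
  route r -> route r' -> atom C -> atom C' ->
  i = (cnt C).-1 :> nat -> i' = (cnt C').-1 :> nat -> G r i = G r' i' ->
  existT (fun X => hom X B) C r = existT (fun X => hom X B) C' r'.
Proof.
move=> rr rr' aC aC' iE i'E.
elim: rr C' r' i' rr' aC' i'E => {B r}
  [|B B' r _ IH|B B' r _ IH|B r _ IH] C' r' i' rr' aC' i'E.
- case: C r' aC i iE rr' => // [p|D] r' _ i iE rr' Gi.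
    by dependent destruction rr'.
  dependent destruction rr'; first by [].
  move: Gi; rewrite G_Comp G_Id fun_etaE => /(congr1 (@nat_of_ord _)).
  by rewrite lift_max iE => /eqP; rewrite gtn_eqF.
- dependent destruction rr'; first by [].
    rewrite 2!(G_Comp (inj1 _ _)) !G_inj1 => /rshift_inj.
    move=> /(IH _ _ _ rr' aC' i'E).
    exact: (congr1 (fun s => existT (fun X => hom X _) _ (inj1 _ _ ∘ projT2 s))).
  rewrite (G_Comp (inj1 _ _)) (G_Comp (inj2 _ _)) G_inj1 G_inj2.
  by move/eqP; rewrite eq_rlshift.
- dependent destruction rr'; first by [].
    rewrite (G_Comp (inj1 _ _)) (G_Comp (inj2 _ _)) G_inj1 G_inj2.
    by move/eqP; rewrite eq_lrshift.
  rewrite 2!(G_Comp (inj2 _ _)) !G_inj2 => /lshift_inj.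
  move=> /(IH _ _ _ rr' aC' i'E).
  exact: (congr1 (fun s => existT (fun X => hom X _) _ (inj2 _ _ ∘ projT2 s))).
- dependent destruction rr'.
    rewrite G_Comp G_Id fun_etaE => /(congr1 (@nat_of_ord _)).
    by rewrite lift_max i'E => /eqP; rewrite ltn_eqF.
  rewrite 2!G_Comp !fun_etaE => /lift_inj.
  move=> /(IH _ _ _ rr' aC' i'E).
  exact: (congr1 (fun s => existT (fun X => hom X _) _ (Eta _ ∘ projT2 s))).
Qed.

(** * Normal arrows *)

(** The predicate recurses on the source alone, for all targets at once: in the
    last clause h has source A but its target T C depends on the route. *)
Fixpoint normal P (A : obj P) : forall B, hom A B -> Prop :=
  match A return forall B, hom A B -> Prop with
  | Letter p => fun B f => exists2 r : hom (Letter p) B, route r & f ≡ r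
  | Unit => fun _ _ => True
  | Tensor A1 A2 => fun B f =>
      normal (f ∘ inj1 A1 A2) /\ normal (f ∘ inj2 A1 A2)
  | T A => fun B f => exists C (r : hom (T C) B) (h : hom A (T C)),
      [/\ route r, normal h & f ≡ r ∘ bind h]
  end.

Lemma normal_eqv P (A B : obj P) (f g : hom A B) :
  f ≡ g -> normal f -> normal g.
Proof.
elim: A B f g => [p||A1 IH1 A2 IH2|A IH] B f g fg //=.
- by case=> r rr fr; exists r; rewrite // -fg.
- by case=> n1 n2; split; [apply: IH1 n1 | apply: IH2 n2]; rewrite fg.
- by move=> [C [r [h [rr nh fr]]]]; exists C, r, h; split=> //; rewrite -fg.
Qed.

Lemma normal_route_post P (A B C : obj P) (s : hom B C) (f : hom A B) :
  route s -> normal f -> normal (s ∘ f).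
Proof.
elim: A B C s f => [p||A1 IH1 A2 IH2|A _] B C s f rs //=.
- move=> [r rr fr]; have [q rq e] := route_comp rs rr.
  by exists q; rewrite // fr.
- move=> [n1 n2]; split.
    by apply: normal_eqv (IH1 _ _ _ _ rs n1); apply: eqv_compA.
  by apply: normal_eqv (IH2 _ _ _ _ rs n2); apply: eqv_compA.
- move=> [D [r [h [rr nh fr]]]]; have [q rq e] := route_comp rs rr.
  by exists D, q, h; split=> //; rewrite fr eqv_compA e.
Qed.

(** The steps of the route are taken off the source of g one at a time. An
    injection selects a component of g. A unit cancels a Kleisli extension: if
    g is s ∘ bind h, then g ∘ Eta is s ∘ h. *)
Lemma normal_route_pre P (A B C : obj P) (g : hom B C) (r : hom A B) :
  route r -> normal g -> normal (g ∘ r).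
Proof.
move=> rr; elim: rr C g => {B r} [|B B' r _ IH|B B' r _ IH|B r _ IH] C g ng.
- by apply: normal_eqv ng; rewrite eqv_idr.
- apply: (@normal_eqv _ _ _ (g ∘ inj1 B B' ∘ r)); first by rewrite -eqv_compA.
  by apply: IH; case: ng.
- apply: (@normal_eqv _ _ _ (g ∘ inj2 B B' ∘ r)); first by rewrite -eqv_compA.
  by apply: IH; case: ng.
- apply: (@normal_eqv _ _ _ (g ∘ Eta B ∘ r)); first by rewrite -eqv_compA.
  apply: IH; case: ng => D [s [h [rs nh gs]]].
  apply: normal_eqv (normal_route_post rs nh).
  by rewrite gs -eqv_compA bind_comp_Eta.
Qed.

Lemma normal_bind P (A B : obj P) (h : hom A (T B)) :
  normal h -> normal (bind h).
Proof.
move=> nh; exists B, (Id _), h.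
by split=> //; [apply: route_id | rewrite eqv_idl].
Qed.

(** By induction on the source of f, g being arbitrary. If f is r ∘ bind h, then
    g ∘ r is normal with source some T D, hence of the form s ∘ bind k, and g ∘ f
    is s ∘ bind (bind k ∘ h), where bind k is normal and the induction hypothesis
    applies to h. *)
Lemma normal_comp P (A B C : obj P) (g : hom B C) (f : hom A B) :
  normal g -> normal f -> normal (g ∘ f).
Proof.
elim: A B C g f => [p||A1 IH1 A2 IH2|A IH] B C g f ng //=.
- move=> [r rr fr].
  suff: normal (g ∘ f) by [].
  by apply: normal_eqv (normal_route_pre rr ng); rewrite fr.
- move=> [n1 n2]; split.
    by apply: normal_eqv (IH1 _ _ _ _ ng n1); apply: eqv_compA.
  by apply: normal_eqv (IH2 _ _ _ _ ng n2); apply: eqv_compA.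
- move=> [D [r [h [rr nh fr]]]].
  have [E [s [k [rs nk gs]]]] := normal_route_pre rr ng.
  exists E, s, (bind k ∘ h); split=> //; first exact: IH (normal_bind nk) nh.
  by rewrite fr eqv_compA gs -eqv_compA bind_bind.
Qed.

Lemma normal_Id P (A : obj P) : normal (Id A).
Proof.
elim: A => [p||A1 IH1 A2 IH2|A IH] //=.
- by exists (Id _); [apply: route_id|].
- split.
    apply: normal_eqv (normal_route_post (route_inj1 A2 (route_id A1)) IH1).
    by rewrite !eqv_idr eqv_idl.
  apply: normal_eqv (normal_route_post (route_inj2 A1 (route_id A2)) IH2).
  by rewrite !eqv_idr eqv_idl.
- exists A, (Id _), (Eta A); split; first exact: route_id.
    apply: normal_eqv (normal_route_post (route_eta (route_id A)) IH).
    by rewrite !eqv_idr.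
  by rewrite bind_Eta eqv_idl.
Qed.

Lemma normal_route P (A B : obj P) (r : hom A B) : route r -> normal r.
Proof.
move=> rr; apply: normal_eqv (normal_route_post rr (normal_Id A)).
by rewrite eqv_idr.
Qed.

Lemma normal_inj1 P (A B : obj P) : normal (inj1 A B).
Proof.
by apply: normal_eqv (normal_route (route_inj1 B (route_id A))); rewrite eqv_idr.
Qed.

Lemma normal_inj2 P (A B : obj P) : normal (inj2 A B).
Proof.
by apply: normal_eqv (normal_route (route_inj2 A (route_id B))); rewrite eqv_idr.
Qed.

Lemma normal_Eta P (A : obj P) : normal (Eta A).
Proof.
by apply: normal_eqv (normal_route (route_eta (route_id A))); rewrite eqv_idr.
Qed.

Lemma normal_tensor P (A B A' B' : obj P) (f : hom A A') (g : hom B B') :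
  normal f -> normal g -> normal (f ⊗ g).
Proof.
move=> nf ng; split.
  by apply: normal_eqv (normal_comp (normal_inj1 A' B') nf); rewrite tensor_inj1.
by apply: normal_eqv (normal_comp (normal_inj2 A' B') ng); rewrite tensor_inj2.
Qed.

Lemma normal_TM P (A B : obj P) (f : hom A B) : normal f -> normal (TM f).
Proof.
move=> nf; apply: normal_eqv (bind_Eta_comp f) _.
exact: normal_bind (normal_comp (normal_Eta B) nf).
Qed.

Lemma normal_Nabla P (A : obj P) : normal (Nabla A).
Proof.
split; apply: normal_eqv (normal_Id A).
  by rewrite eqv_nabla_inj1.
by rewrite eqv_nabla_inj2.
Qed.

Lemma normal_Assoc P (A B C : obj P) : normal (Assoc A B C).
Proof.
split; first split.
- by apply: normal_eqv (normal_inj1 A _); rewrite assoc_inj11.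
- by apply: normal_eqv (normal_comp (normal_inj2 A _) (normal_inj1 B C));
    rewrite assoc_inj12.
- by apply: normal_eqv (normal_comp (normal_inj2 A _) (normal_inj2 B C));
    rewrite assoc_inj2.
Qed.

Lemma normal_AssocV P (A B C : obj P) : normal (AssocV A B C).
Proof.
split; last split.
- apply: normal_eqv (normal_comp (normal_inj1 (Tensor A B) C) (normal_inj1 A B)).
  apply: (cancel_mono (eqv_assocK A B C)).
  by rewrite 2!(eqv_compA (Assoc A B C)) assoc_inj11 eqv_assocVK eqv_idl.
- apply: normal_eqv (normal_comp (normal_inj1 (Tensor A B) C) (normal_inj2 A B)).
  apply: (cancel_mono (eqv_assocK A B C)).
  by rewrite 3!(eqv_compA (Assoc A B C)) assoc_inj12 eqv_assocVK eqv_idl.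
- apply: normal_eqv (normal_inj2 (Tensor A B) C).
  apply: (cancel_mono (eqv_assocK A B C)).
  by rewrite 2!(eqv_compA (Assoc A B C)) assoc_inj2 eqv_assocVK eqv_idl.
Qed.

Lemma normal_psi P (A B : obj P) : normal (psi A B).
Proof.
apply: normal_comp (normal_Nabla _) (normal_tensor _ _).
  exact: normal_TM (normal_inj1 A B).
exact: normal_TM (normal_inj2 A B).
Qed.

Lemma normal_hom P (A B : obj P) (f : hom A B) : normal f.
Proof.
elim: f => {A B}.
- exact: normal_Id.
- by move=> A B C g ng f nf; apply: normal_comp.
- by move=> A B A' B' f nf g ng; apply: normal_tensor.
- by move=> A B f nf; apply: normal_TM.
- exact: normal_Assoc.
- exact: normal_AssocV.
- move=> A; split=> //.
  by apply: normal_eqv (normal_Id A); rewrite lunit_inj2.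
- by move=> A; apply: normal_eqv (normal_inj2 _ A); rewrite lunitV_inj2.
- move=> A; split=> //.
  by apply: normal_eqv (normal_Id A); rewrite runit_inj1.
- by move=> A; apply: normal_eqv (normal_inj1 A _); rewrite runitV_inj1.
- move=> A B; split.
    by apply: normal_eqv (normal_inj2 B A); rewrite sym_inj1.
  by apply: normal_eqv (normal_inj1 B A); rewrite sym_inj2.
- exact: normal_Nabla.
- by [].
- exact: normal_Eta.
- by move=> A; apply: normal_eqv (bind_Id A) (normal_bind (normal_Id _)).
- move=> A B; apply: normal_eqv (eqv_sym (eqv_psiL A B)) _.
  apply: normal_comp (normal_psi A B) _.
  exact: normal_tensor (normal_Id _) (normal_Eta B).
- move=> A B; apply: normal_eqv (eqv_sym (eqv_psiR A B)) _.
  apply: normal_comp (normal_psi A B) _.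
  exact: normal_tensor (normal_Eta A) (normal_Id _).
Qed.

(** * Faithfulness *)

Lemma G_bind_max P (A B : obj P) (h : hom A (T B)) :
  G (bind h) ord_max = ord_max.
Proof. by rewrite G_Comp [G (TM h)]/= fun_Tmax fun_mumax. Qed.

Lemma G_bind_lift P (A B : obj P) (h : hom A (T B)) i :
  G (bind h) (lift ord_max i) = G h i.
Proof. by rewrite G_Comp [G (TM h)]/= fun_Tlift fun_mulift. Qed.

(** After the routes have been identified, the equality of dependent pairs gives
    an equality of terms only by uniqueness of identity proofs on the type of
    objects; as P is an arbitrary type, this is the axiom [eq_rect_eq]. *)
Lemma normal_faithful P (A B : obj P) (f g : hom A B) :
  normal f -> normal g -> G f = G g -> f ≡ g.
Proof.
elim: A B f g => [p||A1 IH1 A2 IH2|A IH] B f g nf ng Gfg.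
- case: nf ng => r rr fr [s rs gs].
  have Grs : G r = G s by rewrite -(G_eqv fr) -(G_eqv gs).
  have e : existT (fun X => hom X B) _ r = existT _ _ s.
    by apply: (@route_unique _ _ _ _ r s ord0 ord0) => //; rewrite Grs.
  by rewrite fr gs (inj_pair2 _ _ _ _ _ e).
- exact: from_unit.
- case: nf ng => nf1 nf2 [ng1 ng2]; apply: copair_ext.
    by apply: IH1 => //; apply/ffunP => i; rewrite (G_Comp f) (G_Comp g) Gfg.
  by apply: IH2 => //; apply/ffunP => i; rewrite (G_Comp f) (G_Comp g) Gfg.
- case: nf ng => C [r [h [rr nh fr]]] [D [s [k [rs nk gs]]]].
  have Gi i : G r (G (bind h) i) = G s (G (bind k) i).
    by rewrite -(G_Comp r) -(G_Comp s) -(G_eqv fr) -(G_eqv gs) Gfg.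
  have e : existT (fun X => hom X B) _ r = existT _ _ s.
    apply: (@route_unique _ _ _ _ r s ord_max ord_max) => //.
    by rewrite -(G_bind_max h) -(G_bind_max k).
  have CD : C = D by case: (congr1 (@projT1 _ _) e).
  case: D / CD in s k rs nk gs Gi e *.
  have rsE : r = s := inj_pair2 _ _ _ _ _ e.
  rewrite fr gs -rsE (IH _ h k nh nk) //; apply/ffunP => i.
  rewrite -(G_bind_lift h) -(G_bind_lift k); apply: (G_route_inj rr).
  by rewrite Gi rsE.
Qed.

Theorem mainTheorem6 (P : Type) (A B : obj P) (f g : hom A B) :
  G f = G g -> f ≡ g.
Proof. exact: normal_faithful (normal_hom f) (normal_hom g). Qed.
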